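(* For every real $M\ge 1$, the addition $\boxplus$ on $[-M,M]$ is commutative but not associative; in particular $\mathbf{A}_{-M,M}=([-M,M],\boxplus,\boxtimes,\le)$ is not a semiring.
   Context: On $[-M,M]$: $a\boxplus b$ equals $a+b$ if $a+b\in[-M,M]$, $M$ if $a+b>M$, and $-M$ if $a+b<-M$; $a\boxtimes b$ equals $a\times b$ if $a\times b\in[-M,M]$, $M$ if $a\times b>M$, and $-M$ if $a\times b<-M$. Here $+,\times,\le$ are the usual operations and order on $\mathbb{R}$. A semiring is required to have associative addition. *)

(* Defs.v *)
From HB Require Import structures.
From mathcomp Require Import all_boot all_order all_algebra.
From mathcomp Require Import reals.

Set Implicit Arguments.
Unset Strict Implicit.
Unset Printing Implicit Defensive.

Import Order.TTheory GRing.Theory Num.Theory.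

Local Open Scope ring_scope.

Record ordered_algebra := OrderedAlgebra {
  carrier : Type;
  oa_add : carrier -> carrier -> carrier;
  oa_mul : carrier -> carrier -> carrier;
  oa_le : rel carrier
}.

(* The zero, the one and the choice operator bundled in the library class are
   existentially quantified: only the two operations of A are prescribed. *)
Definition is_semiring (A : ordered_algebra) : Prop :=
  exists c : GRing.PzSemiRing (carrier A),
    let S : pzSemiRingType := GRing.PzSemiRing.Pack c in
    @GRing.add S = @oa_add A /\ @GRing.mul S = @oa_mul A.

Section Saturation.
Variables (R : realType) (M : R).

Definition sym_itv : Type := {x : R | x \in `[- M, M]}.

Definition saturate (x : R) : R :=
  if x \in `[- M, M] then x else if M < x then M else - M.

Hypothesis M_ge1 : 1 <= M.

Lemma saturate_in (x : R) : saturate x \in `[- M, M].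
Proof.
have M0 : 0 <= M by apply: le_trans M_ge1; exact: ler01.
have NM : - M <= M by rewrite (le_trans _ M0) ?oppr_le0.
rewrite /saturate; case: ifP => // _.
by case: ifP => _; rewrite in_itv /= lexx ?NM.
Qed.

Definition boxplus (a b : sym_itv) : sym_itv :=
  exist _ (saturate (sval a + sval b)) (saturate_in _).

Definition boxtimes (a b : sym_itv) : sym_itv :=
  exist _ (saturate (sval a * sval b)) (saturate_in _).

Definition A_sat : ordered_algebra :=
  OrderedAlgebra boxplus boxtimes (fun a b => sval a <= sval b).

End Saturation.

(* Main.v *)
Require Import Defs.
From mathcomp Require Import all_boot all_order all_algebra.
From mathcomp Require Import reals.

Import Order.TTheory GRing.Theory Num.Theory.

Local Open Scope ring_scope.

(** Clipping acts on the real sum, so commutativity is inherited from [+]. It also forgets any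
    overshoot, so a later subtraction starts from [M], and bracketing matters:
    [boxplus_not_associative]. A semiring with this addition would make it associative. *)

Lemma boxplusC (R : realType) (M : R) (M_ge1 : 1 <= M) :
  commutative (boxplus M_ge1).
Proof. by move=> a b; apply: val_inj; rewrite /= addrC. Qed.

Lemma saturate_id (R : realType) (M x : R) :
  x \in `[- M, M] -> saturate M x = x.
Proof. by rewrite /saturate => ->. Qed.

Lemma saturate_gt (R : realType) (M x : R) : M < x -> saturate M x = M.
Proof. by move=> ltMx; rewrite /saturate in_itv /= (leNgt x) ltMx andbF. Qed.

(* [(M + M) + (- M)] saturates first and gives [0]; [M + (M + (- M))] gives [M]. *)
Lemma boxplus_not_associative (R : realType) (M : R) (M_ge1 : 1 <= M) :
  ~ associative (boxplus M_ge1).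
Proof.
have M_gt0 : 0 < M := lt_le_trans ltr01 M_ge1.
have M_in : M \in `[- M, M] by rewrite in_itv /= lexx andbT ge0_cp // ltW.
have NM_in : - M \in `[- M, M] by rewrite in_itv /= lexx ge0_cp // ltW.
have zero_in : 0 \in `[- M, M] by rewrite in_itv /= oppr_le0 ltW.
pose top : sym_itv M := exist _ M M_in.
pose bot : sym_itv M := exist _ (- M) NM_in.
move=> /(_ top top bot) /(congr1 sval) /=.
rewrite subrr (saturate_id _ _ _ zero_in) addr0 (saturate_id _ _ _ M_in).
(* As [0 < M], the sum [M + M] is clipped to [M]; the lost excess turns the equation into
   [M = 0]. *)
rewrite (@saturate_gt _ _ (M + M)) ?ltrDl // subrr (saturate_id _ _ _ zero_in) => M0.
by rewrite M0 ltxx in M_gt0.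
Qed.

Theorem mainTheorem4 (R : realType) (M : R) (M_ge1 : 1 <= M) :
  [/\ commutative (boxplus M_ge1),
      ~ associative (boxplus M_ge1)
    & ~ is_semiring (A_sat M_ge1)].
Proof.
split; [exact: boxplusC | exact: boxplus_not_associative |].
(* [addE] equates the two additions as functions, so the semiring law [addrA] transfers to
   [boxplus]. *)
case=> c /= [addE _]; apply: (boxplus_not_associative R M M_ge1).
rewrite -addE; exact: (@addrA (GRing.PzSemiRing.Pack c)).
Qed.
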